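(* Let $\mathcal{A}$ be a unital finite-dimensional $*$-algebra with dimension $m$ and let $f:\mathcal{A}\times\mathcal{A}\to\mathbb{C}$ be a sesquilinear map. Fix an isomorphism $\psi:\mathcal{A}\otimes\mathcal{A}\to\mathbb{C}^{m^2}$ and a basis $\mathcal{Q}=\{Q_1,\dots,Q_m\}$ of $\mathcal{A}$. Then the following are equivalent: 1. There exists a positive $m^2\times m^2$ matrix $X$ that is a solution to the system of equations, linear in $X$, given by $$\psi(Q_{i_4}^*\otimes Q_{i_5}^* )^*X\psi(Q_{i_1}(Q_{i_2}\otimes Q_{i_3}))-\psi(Q_{i_1}^*(Q_{i_4}^*\otimes Q_{i_5}^* ))^*X\psi(Q_{i_2}\otimes Q_{i_3})=0\quad(1\le i_1,\dots,i_5\le m),$$ $$\psi(Q_{i_4}^*\otimes Q_{i_5}^* )^*X\psi((Q_{i_2}\otimes Q_{i_3})Q_{i_1})-\psi((Q_{i_4}^*\otimes Q_{i_5}^* )Q_{i_1}^* )^*X\psi(Q_{i_2}\otimes Q_{i_3})=0\quad(1\le i_1,\dots,i_5\le m),$$ $$\psi(Q_{i_2}^*\otimes 1)^*X\psi(Q_{i_1}\otimes 1)-f(Q_{i_1},Q_{i_2}^* )=0\quad(1\le i_1,i_2\le m).$$ 2. There exists a derivation $\delta$, given by $\delta(A)=A\otimes 1$, to the canonical bimodule $\mathcal{A}\otimes\mathcal{A}$ and a positive sesquilinear form $\langle\cdot,\cdot\rangle_{\mathcal{A}\otimes\mathcal{A}}$ on $\mathcal{A}\otimes\mathcal{A}$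 such that $\mathcal{A}\otimes\mathcal{A}$ with this positive sesquilinear form is a $*$-bimodule and for all $A,B\in\mathcal{A}$ we have $\langle\delta(A),\delta(B)\rangle_{\mathcal{A}\otimes\mathcal{A}}=f(A,B)$.
   Context: Algebras are over $\mathbb{C}$. Sesquilinear forms are linear in the first and antilinear in the second coordinate. ''Positive'' (for matrices and forms) means positive semidefinite. $\psi$ is an isomorphism of complex vector spaces; elements of $\mathbb{C}^{m^2}$ are column vectors and $v^*$ is the conjugate transpose of $v$. Canonical bimodule $\mathcal{A}\otimes\mathcal{A}$: the vector space $\mathcal{A}\otimes\mathcal{A}$ with left action $A(B\otimes C)=AB\otimes C-A\otimes BC$ and right action $(B\otimes C)D=B\otimes CD$, so that $A(B\otimes C)D=AB\otimes CD-A\otimes BCD$. Bimodules: an $\mathcal{A}$-$\mathcal{A}$ bimodule is a vector space $H$ with algebra homomorphisms $L$ and $R$ from $\mathcal{A}$ and the opposite algebra $\mathcal{A}^\circ$, respectively, to the linear maps on $H$ such that $L(\mathcal{A})$ and $R(\mathcal{A})$ commute (actions are not assumed unital); write $Ax=L(A)x$, $xA=R(A)x$. An $\mathcal{A}$-$\mathcal{A}$ $*$-bimodule is such a bimodule with a positive sesquilinear form such that $\langle Ax,y\rangle=\langle x,A^*y\rangle$, $\langle xA,y\rangle=\langle x,yA^*\rangle$ for all $x,y\in H$, $A\in\mathcal{A}$, and all $L(A)$, $R(A)$ are bounded. Derivation: a linear map $\delta:\mathcal{A}\to H$ into an $\mathcal{A}$-$\mathcal{A}$ bimodule with $\delta(AB)=A\delta(B)+\delta(A)B$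 for all $A,B\in\mathcal{A}$. *)

(* Defs.v *)
From HB Require Import structures.
From mathcomp Require Import all_boot all_order all_algebra all_field.
From mathcomp Require Import complex reals.

Set Implicit Arguments.
Unset Strict Implicit.
Unset Printing Implicit Defensive.

Import Order.TTheory GRing.Theory Num.Theory VectorInternalTheory.
Local Open Scope ring_scope.
Local Open Scope sesquilinear_scope.

(* The field of complex numbers is R[i] for R : realType.  As always with
   falgType, the algebra is associative and unital with 1 != 0. *)
HB.mixin Record hasStar (R : realType) A of Falgebra R[i] A := {
  star : A -> A;
  starK : involutive star;
  starD : {morph star : a b / a + b};
  starZ : forall (k : R[i]) (a : A), star (k *: a) = Num.conj k *: star a;
  starM : forall a b : A, star (a * b) = star b * star a
}.

#[short(type="starAlgType")]
HB.structure Definition StarAlgebra (R : realType) :=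
  { A of hasStar R A & Falgebra R[i] A }.

(* Linear in the first argument, antilinear in the second. *)
Notation "{ 'sesquilinear' U -> C }" :=
  {bilinear U%type -> U%type -> C%type | *%R & Num.conj \; *%R}
  (at level 0, U at level 98, C at level 99,
   format "{ 'sesquilinear'  U  ->  C }") : type_scope.

(* 0 <= z for z : R[i] says that z is real and nonnegative, so both predicates
   below entail hermitian symmetry. *)
Definition positive_form (R : realType) (H : lmodType R[i])
    (form : {sesquilinear H -> R[i]}) : Prop :=
  forall x, 0 <= form x x.

Definition positive_mx (R : realType) (n : nat) (X : 'M[R[i]]_n) : Prop :=
  forall v : 'cV[R[i]]_n, 0 <= (v ^t* *m X *m v) 0 0.

Section Tensor.
Variable K : fieldType.

(* U (x) V is realised by matrices of coordinates in the reference bases of U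
   and V; tensor_universal below states the universal property. *)
Definition tensor (U V : vectType K) : Type := 'M[K]_(dim U, dim V).

HB.instance Definition _ (U V : vectType K) := Vector.on (tensor U V).

Variables U V : vectType K.

Definition tens (u : U) (v : V) : tensor U V := (v2r u)^T *m v2r v.

Fact tens_is_bilinear : bilinear_for
  (GRing.Scale.Law.clone _ _ *:%R _) (GRing.Scale.Law.clone _ _ *:%R _) tens.
Proof.
split=> [v|u] a x y; rewrite /tens /= linearP.
- by rewrite linearP mulmxDl scalemxAl.
- by rewrite mulmxDr scalemxAr.
Qed.
HB.instance Definition _ :=
  bilinear_isBilinear.Build K U V (tensor U V) _ _ tens tens_is_bilinear.

(* The linear map on U (x) V induced by f; meaningful for bilinear f. *)
Definition tlift (W : lmodType K) (f : U -> V -> W) (t : tensor U V) : W :=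
  \sum_i \sum_j (t : 'M[K]_(_, _)) i j *:
    f (r2v (delta_mx 0 i)) (r2v (delta_mx 0 j)).

Fact tlift_is_linear (W : lmodType K) (f : U -> V -> W) : linear (tlift f).
Proof.
move=> a s t; rewrite /tlift scaler_sumr -big_split; apply: eq_bigr => i _ /=.
rewrite scaler_sumr -big_split; apply: eq_bigr => j _ /=.
by rewrite !mxE scalerDl scalerA.
Qed.
HB.instance Definition _ (W : lmodType K) (f : U -> V -> W) :=
  GRing.isLinear.Build K (tensor U V) W _ (tlift f) (tlift_is_linear f).

Lemma tlift_tensE (W : lmodType K) (f : U -> V -> W) u v :
  (forall y, linear (f ^~ y)) -> (forall x, linear (f x)) ->
  tlift f (tens u v) = f u v.
Proof.
move=> f_l f_r.
pose fB := bilinear_isBilinear.Build K U V W *:%R *:%R f (f_l, f_r).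
pose g : {bilinear U -> V -> W} := HB.pack f fB.
rewrite -[f u v]/(g u v).
have coordE (T : vectType K) (x : T) :
    x = \sum_i v2r x 0 i *: r2v (delta_mx 0 i).
  rewrite -[LHS]v2rK [v2r x in LHS]row_sum_delta linear_sum.
  by apply: eq_bigr => i _; rewrite linearZ.
rewrite [in RHS](coordE _ u) [in RHS](coordE _ v) linear_sumlz.
apply: eq_bigr => i _; rewrite linear_sumr; apply: eq_bigr => j _.
by rewrite linearZl_LR linearZr_LR scalerA !mxE big_ord1 !mxE.
Qed.

Lemma tlift_tens (W : lmodType K) (f : {bilinear U -> V -> W}) u v :
  tlift f (tens u v) = f u v.
Proof. by apply: tlift_tensE => [y|x]; [exact: linearPl|exact: linearPr]. Qed.

Lemma tensor_ind (W : lmodType K) (g h : {linear tensor U V -> W}) :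
  (forall u v, g (tens u v) = h (tens u v)) -> g =1 h.
Proof.
move=> gh t; rewrite [t](matrix_sum_delta (t : 'M[K]_(_, _))) !linear_sum.
apply: eq_bigr => i _; rewrite !linear_sum; apply: eq_bigr => j _.
have -> : delta_mx i j = tens (r2v (delta_mx 0 i)) (r2v (delta_mx 0 j)) :> tensor U V.
  by rewrite /tens !r2vK trmx_delta mul_delta_mx.
by rewrite !(linearZ_LR g) !(linearZ_LR h) gh.
Qed.

Lemma tensor_universal (W : lmodType K) (f : {bilinear U -> V -> W}) :
  exists2 g : {linear tensor U V -> W},
    forall u v, g (tens u v) = f u v
    & forall h : {linear tensor U V -> W},
        (forall u v, h (tens u v) = f u v) -> h =1 g.
Proof.
exists (tlift f : {linear _ -> _}) => [u v|h fh]; first exact: tlift_tens.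
by apply: tensor_ind => u v; rewrite fh /= tlift_tens.
Qed.

End Tensor.

Notation "U ⊗ V" := (tensor U V) (at level 40, left associativity) : type_scope.
Notation "u ⊗ v" := (tens u v) (at level 40, left associativity) : ring_scope.

(* lact a x = a x and ract x a = x a; the actions need not be unital. *)
Record bimodule (R : realType) (A : falgType R[i]) := Bimodule {
  bimodule_sort :> lmodType R[i];
  lact : {bilinear A -> bimodule_sort -> bimodule_sort};
  ract : {bilinear bimodule_sort -> A -> bimodule_sort};
  lactM : forall a b x, lact (a * b) x = lact a (lact b x);
  ractM : forall x a b, ract x (a * b) = ract (ract x a) b;
  lractC : forall a x b, ract (lact a x) b = lact a (ract x b)
}.

Definition derivation (R : realType) (A : falgType R[i]) (H : bimodule A)
    (delta : A -> H) : Prop :=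
  linear delta /\
  forall a b : A, delta (a * b) = lact H a (delta b) + ract H (delta a) b.

Section StarBimodule.
Variables (R : realType) (A : starAlgType R) (H : bimodule A).
Variable form : {sesquilinear H -> R[i]}.

Definition seminorm (x : H) : R[i] := sqrtC (form x x).

Definition bounded_op (T : H -> H) : Prop :=
  exists M : R, forall x, seminorm (T x) <= M%:C%C * seminorm x.

Definition star_bimodule : Prop :=
  [/\ positive_form form,
      forall a x y, form (lact H a x) y = form x (lact H (star a) y),
      forall a x y, form (ract H x a) y = form x (ract H y (star a)),
      forall a, bounded_op (lact H a)
    & forall a, bounded_op (fun x => ract H x a)].

End StarBimodule.

Section Canonical.
Variables (R : realType) (A : falgType R[i]).

(* Fixing U and V makes both factors elaborate to the same vectType on A. *)
Local Notation "b ⊗ c" := (@tens R[i] A A b c) : ring_scope.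

Definition can_lact (a : A) : A ⊗ A -> A ⊗ A :=
  tlift (fun b c : A => (a * b) ⊗ c - a ⊗ (b * c)).

Definition can_ract (t : A ⊗ A) (d : A) : A ⊗ A :=
  tlift (fun b c : A => b ⊗ (c * d)) t.

#[local] Arguments can_lact : simpl never.
#[local] Arguments can_ract : simpl never.

Fact can_lact_is_bilinear : bilinear_for
  (GRing.Scale.Law.clone _ _ *:%R _) (GRing.Scale.Law.clone _ _ *:%R _) can_lact.
Proof.
split=> [t|a] k x y /=; last exact: linearP.
rewrite /can_lact /tlift scaler_sumr -big_split; apply: eq_bigr => i _ /=.
rewrite scaler_sumr -big_split; apply: eq_bigr => j _ /=.
rewrite scalerA mulrC -scalerA -scalerDr; congr (_ *: _).
rewrite mulrDl -scalerAl !linearPl scalerBr opprD addrACA.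
by [].
Qed.
HB.instance Definition _ :=
  bilinear_isBilinear.Build R[i] A (A ⊗ A)%type (A ⊗ A)%type _ _ can_lact
    can_lact_is_bilinear.

Fact can_ract_is_bilinear : bilinear_for
  (GRing.Scale.Law.clone _ _ *:%R _) (GRing.Scale.Law.clone _ _ *:%R _) can_ract.
Proof.
split=> [d|t] k x y /=; first exact: linearP.
rewrite /can_ract /tlift scaler_sumr -big_split; apply: eq_bigr => i _ /=.
rewrite scaler_sumr -big_split; apply: eq_bigr => j _ /=.
rewrite scalerA mulrC -scalerA -scalerDr; congr (_ *: _).
by rewrite mulrDr -scalerAr linearPr.
Qed.
HB.instance Definition _ :=
  bilinear_isBilinear.Build R[i] (A ⊗ A)%type A (A ⊗ A)%type _ _ can_ract
    can_ract_is_bilinear.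

Lemma can_lactE (a b c : A) :
  can_lact a (b ⊗ c) = (a * b) ⊗ c - a ⊗ (b * c).
Proof.
rewrite /can_lact tlift_tensE // => [y|x] k u v /=.
  by rewrite mulrDr -scalerAr mulrDl -scalerAl linearPl linearPr scalerBr opprD addrACA.
by rewrite mulrDr -scalerAr !linearPr scalerBr opprD addrACA.
Qed.

Lemma can_ractE (b c d : A) : can_ract (b ⊗ c) d = b ⊗ (c * d).
Proof.
rewrite /can_ract tlift_tensE // => [y|x] k u v /=; first by rewrite linearPl.
by rewrite mulrDl -scalerAl linearPr.
Qed.

Fact can_lactM (a b : A) (x : A ⊗ A) :
  can_lact (a * b) x = can_lact a (can_lact b x).
Proof.
apply: (tensor_ind (U := A) (V := A) (g := can_lact (a * b)) (h := can_lact a \o can_lact b)).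
move=> c d; change (can_lact (a * b) (c ⊗ d) = can_lact a (can_lact b (c ⊗ d))).
rewrite !can_lactE linearBr /= !can_lactE !mulrA.
by rewrite opprB addrA subrK.
Qed.

Fact can_ractM (x : A ⊗ A) (a b : A) :
  can_ract x (a * b) = can_ract (can_ract x a) b.
Proof.
apply: (tensor_ind (U := A) (V := A) (g := applyr can_ract (a * b))
          (h := applyr can_ract b \o applyr can_ract a)) => c d.
change (can_ract (c ⊗ d) (a * b) = can_ract (can_ract (c ⊗ d) a) b).
by rewrite !can_ractE mulrA.
Qed.

Fact can_lractC (a : A) (x : A ⊗ A) (b : A) :
  can_ract (can_lact a x) b = can_lact a (can_ract x b).
Proof.
apply: (tensor_ind (U := A) (V := A) (g := applyr can_ract b \o can_lact a)
          (h := can_lact a \o applyr can_ract b)) => c d.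
change (can_ract (can_lact a (c ⊗ d)) b = can_lact a (can_ract (c ⊗ d) b)).
by rewrite can_lactE linearBl /= !can_ractE can_lactE mulrA.
Qed.

Definition canonical_bimodule : bimodule A :=
  @Bimodule R A (A ⊗ A)%type can_lact can_ract can_lactM can_ractM can_lractC.

End Canonical.

(* Main.v *)
Require Import Defs.
From HB Require Import structures.
From mathcomp Require Import all_boot all_order all_algebra all_field.
From mathcomp Require Import complex reals ring.

Set Implicit Arguments.
Unset Strict Implicit.
Unset Printing Implicit Defensive.

Import Order.TTheory GRing.Theory Num.Theory.
Local Open Scope ring_scope.
Local Open Scope sesquilinear_scope.

(** The isomorphism psi identifies sesquilinear forms on A ⊗ A with matrices,
    the form of X being (x, y) |-> psi(y)^* X psi(x), and it identifies positive
    forms with positive matrices ([matrix_form_surj], [matrix_form_ge0]).  Under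
    this identification the three families of equations say that left and right
    multiplication by a have the multiplications by a^* as adjoints, and that
    the form pulls back to f along a |-> a ⊗ 1, tested on basis vectors.  Since
    the two sides of each identity are linear, or antilinear, in the same
    variables, and since the adjoints of a basis again form a basis, the tests on
    basis vectors suffice ([adjoint_spans], [sesquilinear_spans]).

    What the equations do not state is that the multiplications are bounded for
    the seminorm of the form.  This is automatic in finite dimension, although
    the form may be degenerate ([adjointable_bounded_op]).  By the spectral
    theorem there is a basis e_1, ..., e_n that is orthogonal for the form
    ([matrix_form_orthogonal]), so that the squared seminorm of sum_i c_i e_i is
    sum_i |c_i|^2 <e_i, e_i>.  An operator T with an adjoint S maps null vectors
    to null vectors, because <T x, T x> = <x, S (T x)> and a null vector is
    orthogonal to everything; hence |T e_i|^2 is a multiple of |e_i|^2, even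
    where e_i is null, and finitely many such multiples bound T
    ([adjointable_bound]). *)

(** * Positive forms and adjointable operators *)

Section PositiveForm.
Variables (R : realType) (H : lmodType R[i]) (form : {sesquilinear H -> R[i]}).
Hypothesis form_ge0 : positive_form form.

(** Polarization: <u, v> + <v, u> is a combination of values on the diagonal,
    hence real; the pairs (x, y) and (x, i y) determine <y, x>. *)
Lemma positive_formC x y : form y x = Num.conj (form x y).
Proof.
have realD u v : Num.conj (form u v + form v u) = form u v + form v u.
  apply/CrealP.
  have -> : form u v + form v u = form (u + v) (u + v) - form u u - form v v.
    by rewrite linearDl /= !linearDr /=; ring.
  by rewrite !rpredB ?ger0_real ?form_ge0.
have := realD x ('i *: y); rewrite linearZl_LR /= linearZr_LR /=.
have := realD x y.
set a := form x y; set b := form y x.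
rewrite !rmorphD !rmorphM /= conjCK conjCi => e1 e2.
have e3 : Num.conj a - Num.conj b = b - a.
  apply: (mulfI (neq0Ci R[i])); rewrite mulrBr -mulNr e2; ring.
apply: (mulIf (x := 2)); first by rewrite pnatr_eq0.
have -> : b * 2 = (a + b) + (b - a) by ring.
by rewrite -e1 -e3; ring.
Qed.

(** The case of Cauchy-Schwarz in which one vector is null: otherwise
    <y - k x, y - k x> is real-affine in k, not constant, and takes negative values. *)
Lemma positive_form_null x y : form x x = 0 -> form x y = 0.
Proof.
move=> x0; apply/eqP; apply: contraT => xy0.
(* This k makes the value at y - k x equal to - <y, y> - 2. *)
pose k := (form y y + 1) / form x y.
have kE : k * form x y = form y y + 1 by rewrite divfK.
have yy1 : Num.conj (form y y + 1) = form y y + 1.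
  by apply/CrealP; rewrite ger0_real // addr_ge0.
have kE' : Num.conj k * form y x = form y y + 1.
  by rewrite [form y x]positive_formC -[RHS]yy1 -kE; apply: esym; exact: rmorphM.
have := form_ge0 (y - k *: x).
rewrite linearBl /= !linearBr /= !linearZl_LR /= !linearZr_LR /= x0 !mulr0 subr0.
rewrite kE kE'.
have -> : form y y - (form y y + 1) - (form y y + 1) = - (form y y + (1 + 1)).
  by ring.
rewrite oppr_ge0 => le0.
have : 0 < form y y + (1 + 1) by rewrite ltr_wpDl ?form_ge0 ?addr_gt0.
by move=> /lt_geF; rewrite le0.
Qed.

(** Sum of the nonnegative numbers <y_i - y_j, y_i - y_j> over all i and j. *)
Lemma positive_form_sum n (y : 'I_n -> H) :
  form (\sum_i y i) (\sum_i y i) <= n%:R * \sum_i form (y i) (y i).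
Proof.
set s := \sum_i y i.
have : 0 <= \sum_i \sum_j form (y i - y j) (y i - y j).
  by rewrite !sumr_ge0 // => i _; rewrite sumr_ge0.
have -> : \sum_i \sum_j form (y i - y j) (y i - y j)
    = 2 * (n%:R * \sum_i form (y i) (y i)) - 2 * form s s.
  transitivity (\sum_i (n%:R * form (y i) (y i) - form (y i) s
                        - (form s (y i) - \sum_j form (y j) (y j)))).
    apply: eq_bigr => i _; rewrite linear_sumr linear_sumlz -!sumrB.
    rewrite mulr_natl -[X in _ *+ X]card_ord -sumr_const -!sumrB.
    by apply: eq_bigr => j _; rewrite linearBl /= !linearBr.
  rewrite !sumrB -mulr_sumr -linear_sumlz -linear_sumr sumr_const card_ord.
  by rewrite !mulr_natl !mulr2n opprB opprD addrACA !addrA.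
by rewrite -mulrBr pmulr_rge0 ?ltr0n // subr_ge0.
Qed.

Lemma orthogonal_form_sum n (e : 'I_n -> H) (c : 'I_n -> R[i]) :
    (forall i j, i != j -> form (e i) (e j) = 0) ->
  form (\sum_i c i *: e i) (\sum_i c i *: e i)
    = \sum_i `|c i| ^+ 2 * form (e i) (e i).
Proof.
move=> ortho; rewrite linear_sumlz; apply: eq_bigr => i _.
rewrite linear_sumr (bigD1 i) //= big1 => [|j ji].
  by rewrite addr0 linearZl_LR /= linearZr_LR /= mulrA normCK.
by rewrite linearZl_LR linearZr_LR /= ortho ?mulr0 // eq_sym.
Qed.

(** On a spanning orthogonal family the bound reduces to the ratios
    |T e_i|^2 / |e_i|^2.  The adjoint S serves only to show that T preserves null
    vectors, so that these ratios control T e_i even when e_i is null. *)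
Lemma adjointable_bound n (e : 'I_n -> H) (T : {linear H -> H}) (S : H -> H) :
    (forall i j, i != j -> form (e i) (e j) = 0) ->
    (forall x, exists c : 'I_n -> R[i], x = \sum_i c i *: e i) ->
    (forall x y, form (T x) y = form x (S y)) ->
  exists2 k : R[i], 0 <= k & forall x, form (T x) (T x) <= k * form x x.
Proof.
move=> ortho span adj.
(* For null e_i the ratio r i is 0, since inversion sends 0 to 0. *)
pose r i := form (T (e i)) (T (e i)) / form (e i) (e i).
have r_ge0 i : 0 <= r i by rewrite divr_ge0.
have TE i : form (T (e i)) (T (e i)) = r i * form (e i) (e i).
  have [e0|e0] := eqVneq (form (e i) (e i)) 0; last by rewrite divfK.
  by rewrite e0 mulr0 adj positive_form_null.
exists (n%:R * \sum_i r i) => [|x]; first by rewrite mulr_ge0 ?sumr_ge0.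
have [c ->] := span x.
rewrite (orthogonal_form_sum _ ortho) linear_sum.
apply: le_trans (positive_form_sum _) _; rewrite -mulrA ler_wpM2l //.
rewrite mulr_sumr ler_sum // => i _.
rewrite linearZ_LR linearZl_LR linearZr_LR /= mulrA -normCK TE mulrCA.
rewrite ler_wpM2r ?mulr_ge0 ?exprn_ge0 //.
by rewrite (bigD1 i) //= lerDl sumr_ge0.
Qed.

End PositiveForm.

(** * Forms given by matrices *)

Section MatrixForm.
Variables (R : realType) (H : lmodType R[i]) (n : nat).
Variables (psi : {linear H -> 'cV[R[i]]_n}) (X : 'M[R[i]]_n).

Definition matrix_form (x y : H) : R[i] :=
  ((psi y) ^t* *m X *m psi x) 0 0.

Fact matrix_form_is_bilinear : bilinear_for
  (GRing.Scale.Law.clone _ _ *%R _)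
  (GRing.Scale.Law.clone _ _ (Num.conj \; *%R) _) matrix_form.
Proof.
split=> [y|x] k u v; rewrite /matrix_form /= linearP.
  by rewrite mulmxDr -scalemxAr !mxE.
by rewrite linearP /= map_mxD map_mxZ !mulmxDl -!scalemxAl !mxE.
Qed.
HB.instance Definition _ := bilinear_isBilinear.Build R[i] H H R[i] _ _
  matrix_form matrix_form_is_bilinear.

End MatrixForm.

(** Spanning by a family indexed by any finite type: for tensor products the
    index is a pair, which sequences of generators would have to encode. *)
Definition spans (K : fieldType) (V : lmodType K) (I : finType) (b : I -> V) :=
  forall v, exists c : I -> K, v = \sum_i c i *: b i.

Lemma spans_matrix_cols (K : fieldType) (V : lmodType K) (n : nat)
    (psi : {linear V -> 'cV[K]_n}) (P : 'M[K]_n) (e : 'I_n -> V) :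
    injective psi -> P \in unitmx -> (forall i, psi (e i) = col i P) ->
  forall v, v = \sum_i (invmx P *m psi v) i 0 *: e i.
Proof.
move=> psi_inj P_unit eE v; apply: psi_inj; rewrite linear_sum.
rewrite -[LHS](mulKVmx P_unit); apply/colP => i; rewrite [LHS]mxE summxE.
by apply: eq_bigr => j _; rewrite linearZ eE !mxE mulrC.
Qed.

(** The matrix is the Gram matrix of the vectors that psi sends to the standard
    basis. *)
Lemma matrix_form_surj (R : realType) (H : lmodType R[i]) (n : nat)
    (psi : {linear H -> 'cV[R[i]]_n}) (form : {sesquilinear H -> R[i]}) :
  bijective psi -> exists X, forall x y, form x y = matrix_form psi X x y.
Proof.
move=> psi_bij; have [g gK Kg] := psi_bij.
pose b (j : 'I_n) := g (delta_mx j 0 : 'cV_n).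
have bE j : psi (b j) = col j 1%:M by rewrite /b Kg col1.
have coordE x : x = \sum_j psi x j 0 *: b j.
  have := spans_matrix_cols (bij_inj psi_bij) (unitmx1 _ _) bE x.
  by rewrite invmx1 mul1mx.
exists (\matrix_(i, j) form (b j) (b i)) => x y.
rewrite {1}(coordE x) {1}(coordE y) linear_sumlz /matrix_form mxE.
apply: eq_bigr => j _; rewrite linear_sumr mxE mulr_suml.
apply: eq_bigr => i _; rewrite linearZl_LR linearZr_LR !mxE /=.
by ring.
Qed.

Lemma matrix_form_ge0 (R : realType) (H : lmodType R[i]) (n : nat)
    (psi : {linear H -> 'cV[R[i]]_n}) (X : 'M[R[i]]_n) :
  bijective psi -> positive_form (matrix_form psi X) <-> positive_mx X.
Proof.
move=> [g _ Kg]; split=> [X_ge0 v|X_ge0 x]; last exact: X_ge0.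
by have := X_ge0 (g v); rewrite /= /matrix_form Kg.
Qed.

Lemma positive_mx_herm (R : realType) (n : nat) (X : 'M[R[i]]_n) :
  positive_mx X -> X \is hermsymmx.
Proof.
move=> X_ge0; apply/is_hermitianmxP; rewrite expr0 scale1r.
have form_ge0 : positive_form (matrix_form idfun X) by [].
have entry i j : X i j = matrix_form idfun X (delta_mx j 0) (delta_mx i 0).
  rewrite /matrix_form /= trmx_delta map_delta_mx -rowE -colE !mxE //.
apply/matrixP => i j; rewrite !mxE !entry.
exact: (positive_formC form_ge0).
Qed.

(** The spectral theorem gives X = P^* D P with P unitary and D diagonal; the
    vectors e_i that psi sends to the columns of P^* then have Gram matrix D.
    They need not be orthonormal, as D may vanish. *)
Lemma matrix_form_orthogonal (R : realType) (H : lmodType R[i]) (n : nat)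
    (psi : {linear H -> 'cV[R[i]]_n}) (X : 'M[R[i]]_n) :
    bijective psi -> positive_mx X ->
  exists2 e : 'I_n -> H, spans e
    & forall i j, i != j -> matrix_form psi X (e i) (e j) = 0.
Proof.
move=> psi_bij X_ge0; have [g gK Kg] := psi_bij.
pose P := spectralmx X; pose d := spectral_diag X.
have P_unitary : P \is unitarymx := spectral_unitarymx X.
have XE : X = P ^t* *m diag_mx d *m P.
  rewrite -(invmx_unitary P_unitary).
  exact/orthomx_spectralP/hermitian_normalmx/positive_mx_herm.
have PPt : P *m P ^t* = 1%:M by apply/unitarymxP.
pose e i := g (col i (P ^t*)).
have Pt_unit : P ^t* \in unitmx by rewrite unitarymx_unit ?trmxC_unitary.
exists e => [v|i j ij].
  exists (fun i => (invmx (P ^t*) *m psi v) i 0).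
  by apply: spans_matrix_cols => // [|i]; [exact: bij_inj|rewrite /e Kg].
have -> : matrix_form psi X (e i) (e j) = (P *m X *m P ^t*) j i.
  rewrite /matrix_form /e !Kg !colE trmx_mul map_mxM trmxCK.
  rewrite trmx_delta map_delta_mx !mulmxA -rowE -colE mxE -!row_mul mxE //.
rewrite XE !mulmxA PPt mul1mx -mulmxA PPt mulmx1 !mxE eq_sym (negPf ij).
by rewrite mulr0n.
Qed.

(** * Boundedness of adjointable operators *)

Lemma sqr_bounded_op (R : realType) (A : starAlgType R) (H : bimodule A)
    (form : {sesquilinear H -> R[i]}) (T : H -> H) (k : R[i]) :
    positive_form form -> 0 <= k ->
    (forall x, form (T x) (T x) <= k * form x x) ->
  bounded_op form T.
Proof.
move=> form_ge0 k_ge0 Tk; exists (complex.Re (sqrtC k)) => x; rewrite /seminorm.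
rewrite RRe_real ?ger0_real ?sqrtC_ge0 // -sqrtCM ?nnegrE ?form_ge0 //.
by rewrite ler_sqrtC ?nnegrE ?form_ge0 ?mulr_ge0 ?form_ge0.
Qed.

(** The boundedness required of a *-bimodule is a consequence of the adjoint
    identities, because the underlying space is finite-dimensional. *)
Lemma adjointable_bounded_op (R : realType) (A : starAlgType R)
    (H : bimodule A) (n : nat) (psi : {linear H -> 'cV[R[i]]_n})
    (X : 'M[R[i]]_n) (T : {linear H -> H}) (S : H -> H) :
    bijective psi -> positive_mx X ->
    (forall x y, matrix_form psi X (T x) y = matrix_form psi X x (S y)) ->
  bounded_op (matrix_form psi X) T.
Proof.
move=> psi_bij X_ge0 adj.
have form_ge0 : positive_form (matrix_form psi X) by apply/matrix_form_ge0.
have [e e_span ortho] := matrix_form_orthogonal psi_bij X_ge0.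
have [k k_ge0 Tk] := adjointable_bound form_ge0 ortho e_span adj.
exact: sqr_bounded_op Tk.
Qed.

(** * Checking identities on spanning families *)

Section Spanning.
Variable K : fieldType.

Lemma spans_ind (V : lmodType K) (I : finType) (b : I -> V) (P : V -> Prop) :
    spans b -> P 0 -> (forall k u v, P u -> P v -> P (k *: u + v)) ->
    (forall i, P (b i)) ->
  forall v, P v.
Proof.
move=> b_span P0 PD Pb v; have [c ->] := b_span v.
elim/big_rec: _ => // i u _ Pu; exact: PD.
Qed.

Lemma basis_spans (V : vectType K) (n : nat) (Q : n.-tuple V) :
  basis_of {:V} Q -> spans (tnth Q).
Proof.
move=> Qb v; exists (fun i => coord Q i v).
rewrite [LHS](coord_basis Qb (memvf v)); apply: eq_bigr => i _.
by rewrite (tnth_nth 0).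
Qed.

Lemma spans_tens (U V : vectType K) (I J : finType) (b : I -> U) (c : J -> V) :
  spans b -> spans c -> spans (fun p : I * J => b p.1 ⊗ c p.2).
Proof.
move=> b_span c_span t.
pose P (s : (U ⊗ V)%type) :=
  exists k : I * J -> K, s = \sum_p k p *: (b p.1 ⊗ c p.2).
have P0 : P 0 by exists (fun=> 0); rewrite big1 // => p _; rewrite scale0r.
have PD k s1 s2 : P s1 -> P s2 -> P (k *: s1 + s2).
  move=> [k1 ->] [k2 ->]; exists (fun p => k * k1 p + k2 p).
  rewrite scaler_sumr -big_split; apply: eq_bigr => p _ /=.
  by rewrite scalerDl scalerA.
have P_tens u v : P (u ⊗ v).
  move: v; apply: (spans_ind c_span) => [|k v1 v2 IH1 IH2|j].
  - by rewrite linear0r.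
  - by rewrite linearPr; apply: PD.
  move: u; apply: (spans_ind b_span) => [|k u1 u2 IH1 IH2|i].
  - by rewrite linear0l.
  - by rewrite linearPl; apply: PD.
  exists (fun p => (p == (i, j))%:R); rewrite (bigD1 (i, j)) //= eqxx scale1r.
  by rewrite big1 ?addr0 // => p /negPf->; rewrite scale0r.
have -> : t = tlift (@tens K U V) t.
  apply: (tensor_ind (g := idfun) (h := tlift (@tens K U V))) => u v /=.
  by rewrite tlift_tens.
rewrite -/(P _) /tlift; elim/big_rec: _ => // i s _ Ps.
elim/big_rec: _ => [|j s' _ IH]; first by rewrite add0r.
by rewrite -addrA; apply: PD.
Qed.

End Spanning.

Lemma star0 (R : realType) (A : starAlgType R) : star (0 : A) = 0.
Proof. by rewrite -[0 in LHS](scale0r 0) starZ rmorph0 scale0r. Qed.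

Lemma star_spans (R : realType) (A : starAlgType R) (I : finType) (b : I -> A) :
  spans b -> spans (fun i => star (b i)).
Proof.
move=> b_span a; have [c cE] := b_span (star a).
exists (fun i => Num.conj (c i)); rewrite -[LHS]starK cE.
rewrite (big_morph _ (@starD R A) (star0 A)).
by apply: eq_bigr => i _; rewrite starZ.
Qed.

Section Extension.
Variables (R : realType) (A : starAlgType R).

(** Both sides are linear in a and in x and antilinear in y: on the right, the
    antilinearity of star and that of the second argument cancel in a. *)
Lemma adjoint_spans (H : lmodType R[i]) (form : {sesquilinear H -> R[i]})
    (T : A -> H -> H) (I J L : finType) (q : I -> A) (b : J -> H) (c : L -> H) :
    (forall a, linear (T a)) -> (forall x, linear (T ^~ x)) ->
    spans q -> spans b -> spans c ->
    (forall i j l,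
      form (T (q i) (b j)) (c l) = form (b j) (T (star (q i)) (c l))) ->
  forall a x y, form (T a x) y = form x (T (star a) y).
Proof.
move=> T_linr T_linl q_span b_span c_span TE.
have T0l x : T 0 x = 0.
  by have := T_linl x (-1) 0 0; rewrite !scaleN1r oppr0 addr0 addNr.
have T0r a : T a 0 = 0.
  by have := T_linr a (-1) 0 0; rewrite !scaleN1r oppr0 addr0 addNr.
move=> a x y; move: y; apply: (spans_ind c_span) => [|k y1 y2 IH1 IH2|l].
- by rewrite T0r !linear0r.
- by rewrite T_linr !linearPr IH1 IH2.
move: x; apply: (spans_ind b_span) => [|k x1 x2 IH1 IH2|j].
- by rewrite T0r !linear0l.
- by rewrite T_linr !linearPl IH1 IH2.
move: a; apply: (spans_ind q_span) => [|k a1 a2 IH1 IH2|i]; last exact: TE.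
- by rewrite star0 !T0l linear0l linear0r.
- by rewrite starD starZ !T_linl linearPl linearPr IH1 IH2 /= conjCK.
Qed.

Lemma sesquilinear_spans (V : lmodType R[i])
    (form1 form2 : {sesquilinear V -> R[i]}) (I J : finType)
    (b : I -> V) (c : J -> V) :
    spans b -> spans c -> (forall i j, form1 (b i) (c j) = form2 (b i) (c j)) ->
  forall x y, form1 x y = form2 x y.
Proof.
move=> b_span c_span e x y.
move: y; apply: (spans_ind c_span) => [|k y1 y2 IH1 IH2|j]; rewrite ?linear0r //.
  by rewrite !linearPr IH1 IH2.
move: x; apply: (spans_ind b_span) => [|k x1 x2 IH1 IH2|i]; rewrite ?linear0l //.
by rewrite !linearPl IH1 IH2.
Qed.

(** In a (b ⊗ 1) = a b ⊗ 1 - a ⊗ b the second term is cancelled by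
    (a ⊗ 1) b = a ⊗ b. *)
Lemma canonical_derivation (delta : A -> canonical_bimodule A) :
  (forall a, delta a = a ⊗ (1 : A)) -> derivation delta.
Proof.
move=> dE; split=> [k a b|a b]; rewrite !dE; first exact: linearPl.
by rewrite /= can_lactE can_ractE mulr1 mul1r subrK.
Qed.

End Extension.

(** * The equivalence *)

Theorem theorem4p1 (R : realType) (A : starAlgType R) (m : nat)
    (hm : \dim {:A} = m) (f : {sesquilinear A -> R[i]})
    (psi : {linear (A ⊗ A)%type -> 'cV[R[i]]_(m ^ 2)}) (hpsi : bijective psi)
    (Q : m.-tuple A) (hQ : basis_of {:A} Q) :
  (exists2 X : 'M[R[i]]_(m ^ 2), positive_mx X &
    let q := tnth Q in
    [/\ forall i1 i2 i3 i4 i5 : 'I_m,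
          (psi (star (q i4) ⊗ star (q i5))) ^t* *m X
              *m psi (can_lact (q i1) (q i2 ⊗ q i3))
          - (psi (can_lact (star (q i1)) (star (q i4) ⊗ star (q i5)))) ^t* *m X
              *m psi (q i2 ⊗ q i3) = 0,
        forall i1 i2 i3 i4 i5 : 'I_m,
          (psi (star (q i4) ⊗ star (q i5))) ^t* *m X
              *m psi (can_ract (q i2 ⊗ q i3) (q i1))
          - (psi (can_ract (star (q i4) ⊗ star (q i5)) (star (q i1)))) ^t* *m X
              *m psi (q i2 ⊗ q i3) = 0
      & forall i1 i2 : 'I_m,
          ((psi (star (q i2) ⊗ (1 : A))) ^t* *m X *m psi (q i1 ⊗ (1 : A))) 0 0
          - f (q i1) (star (q i2)) = 0])
  <->
  (exists delta : A -> canonical_bimodule A,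
    [/\ forall a, delta a = a ⊗ (1 : A),
        derivation delta
      & exists form : {sesquilinear canonical_bimodule A -> R[i]},
          [/\ positive_form form,
              star_bimodule form
            & forall a b, form (delta a) (delta b) = f a b]]).
Proof.
have q_span := basis_spans hQ; have sq_span := star_spans q_span.
split=> [[X X_ge0 [lactX ractX fX]]|].
(* Psi is psi seen on the carrier of the bimodule, which is A ⊗ A. *)
- pose Psi : {linear canonical_bimodule A -> 'cV[R[i]]_(m ^ 2)} := psi.
  have adjl a x y : matrix_form Psi X (lact (canonical_bimodule A) a x) y
      = matrix_form Psi X x (lact (canonical_bimodule A) (star a) y).
    move: a x y; apply: adjoint_spans q_span (spans_tens q_span q_span)
      (spans_tens sq_span sq_span) _ => [a k x y|x k a b|i1 [i2 i3] [i4 i5]].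
    + exact: linearPr.
    + exact: linearPl.
    have /matrixP/(_ 0 0) := subr0_eq (lactX i1 i2 i3 i4 i5).
    exact.
  have adjr a x y : matrix_form Psi X (ract (canonical_bimodule A) x a) y
      = matrix_form Psi X x (ract (canonical_bimodule A) y (star a)).
    move: a x y; pose T a x := ract (canonical_bimodule A) x a.
    apply: (adjoint_spans (T := T)) q_span (spans_tens q_span q_span)
      (spans_tens sq_span sq_span) _ => [a k x y|x k a b|i1 [i2 i3] [i4 i5]].
    + exact: linearPl.
    + exact: linearPr.
    have /matrixP/(_ 0 0) := subr0_eq (ractX i1 i2 i3 i4 i5).
    exact.
  exists (fun a => a ⊗ (1 : A)); split=> //; first exact: canonical_derivation.
  have form_ge0 : positive_form (matrix_form Psi X) by apply/matrix_form_ge0.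
  have bl a := adjointable_bounded_op (T := lact (canonical_bimodule A) a)
    hpsi X_ge0 (adjl a).
  have br a := adjointable_bounded_op
    (T := applyr (ract (canonical_bimodule A)) a) hpsi X_ge0 (adjr a).
  exists (matrix_form Psi X); split; first exact: form_ge0.
    split; [exact: form_ge0|exact: adjl|exact: adjr|exact: bl|exact: br].
  (* The pullback of the form along a |-> a ⊗ 1 is the form that X defines on A
     through psi (a ⊗ 1). *)
  apply: (sesquilinear_spans (form2 := f)
    (form1 := matrix_form (Psi \o applyr (@tens _ A A) 1) X) q_span sq_span).
  by move=> i j; exact: subr0_eq (fX i j).
move=> [delta [deltaE _ [form [form_ge0 sform formE]]]].
have [X formX] := matrix_form_surj form hpsi.
have formXE x y : form x y = ((psi y) ^t* *m X *m psi x) 0 0 by rewrite formX.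
have X_ge0 : positive_mx X.
  apply/(matrix_form_ge0 X hpsi) => x.
  by have := form_ge0 x; rewrite formX.
have [_ adjl adjr _ _] := sform.
exists X => //= ; split=> [i1 i2 i3 i4 i5|i1 i2 i3 i4 i5|i1 i2].
- apply/eqP; rewrite subr_eq0; apply/eqP/matrixP => i j; rewrite !ord1.
  rewrite -!formXE; exact: adjl.
- apply/eqP; rewrite subr_eq0; apply/eqP/matrixP => i j; rewrite !ord1.
  rewrite -!formXE; exact: adjr.
- apply/eqP; rewrite subr_eq0 -formE !deltaE formXE; exact/eqP.
Qed.
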